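(* Let $K$ be a field and let $G$ be a finite simple graph. Suppose there is a vertex $x$ of $G$ whose set of neighbours is $\{a_1,\dots,a_n\}$, $n\ge 1$, and that the vertices $a_1,\dots,a_n$ are pairwise connected to each other by edges (for $n=1$ this last condition is void). For each $i$ let $G_i$ be the graph obtained from $G$ by deleting $a_i$ and all vertices connected to $a_i$. Then $$H^\bullet(A_G)\cong H^\bullet(A_{G_1})\oplus\cdots\oplus H^\bullet(A_{G_n})$$ as vector spaces (total homology).
   Context: For a finite simple graph $G$ with vertices $x_1,\dots,x_N$, $A_G$ is the quotient of the Grassmann (exterior) algebra over $K$ on generators $x_1,\dots,x_N$ by the ideal generated by the monomials $x_ix_j$ for all edges $\{x_i,x_j\}$ of $G$. It is regarded as a complex, graded by degree, with differential $D(\xi)=(x_1+\cdots+x_N)\xi$, and $H^\bullet(A_G)=\ker D/\operatorname{im}D$ is its total homology. ($G$ plays the role of the graph of relations of a quadratic monomial operad.) Deleting a vertex means removing it and all edges incident to it, but not the vertices at the other ends of those edges. For the empty graph, $A_G=K$ with zero differential. *)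

(* Defs.v *)
From HB Require Import structures.
From mathcomp Require Import all_boot all_order all_algebra all_field.

Set Implicit Arguments.
Unset Strict Implicit.
Unset Printing Implicit Defensive.

Import GRing.Theory.
Local Open Scope ring_scope.

Record sgraph := SGraph {
  vertex :> finType;
  adj : rel vertex;
  adj_sym : symmetric adj;
  adj_irrefl : irreflexive adj
}.

Definition nbhd (G : sgraph) (x : G) : {set G} := [set y | adj x y].

Section DeleteVertices.
Variables (G : sgraph) (S : {set G}).

Let dvertex : finType := {y : G | y \notin S}.
Let dadj : rel dvertex := fun y z => adj (val y) (val z).

Fact del_sym : symmetric dadj.
Proof. by move=> y z; apply: adj_sym. Qed.

Fact del_irrefl : irreflexive dadj.
Proof. by move=> y; apply: adj_irrefl. Qed.

Definition del : sgraph := SGraph del_sym del_irrefl.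

End DeleteVertices.

(* The Grassmann algebra on a finite set T of generators, on the basis of the *)
(* monomials e_S = x_{i_1} ... x_{i_k}, S = {i_1 < ... < i_k} a subset of T,  *)
(* where T is ordered by enum_rank. One has e_S e_S' = 0 unless S and S' are  *)
(* disjoint, and then e_S e_S' = (-1)^(gr_inv S S') e_(S :|: S').             *)
Definition grassmann (K : fieldType) (T : finType) := {ffun {set T} -> K^o}.

HB.instance Definition _ (K : fieldType) (T : finType) :=
  Vector.copy (grassmann K T) {ffun {set T} -> K^o}.

Section Grassmann.
Variables (K : fieldType) (T : finType).
Local Notation E := (grassmann K T).
Implicit Types (S U W : {set T}) (f g h : E) (x y : T).

Definition gr_inv (S U : {set T}) : nat :=
  (\sum_(i in S) \sum_(j in U) (enum_rank j < enum_rank i))%N.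

Definition gr_sign S U : K := (-1) ^+ gr_inv S U.

Definition gr_monom S : E := [ffun U => (U == S)%:R].

Definition gr_gen x : E := gr_monom [set x].

Definition gr_mul f g : E :=
  [ffun U : {set T} => \sum_(S : {set T} | S \subset U)
     gr_sign S (U :\: S) * (f S * g (U :\: S))].

Lemma inv_splitl S W U :
  S \subset W -> gr_inv W U = (gr_inv S U + gr_inv (W :\: S) U)%N.
Proof. by move=> /setIidPr SW; rewrite /gr_inv (big_setID S) /= SW. Qed.

Lemma inv_splitr S W U :
  U \subset W -> gr_inv S W = (gr_inv S U + gr_inv S (W :\: U))%N.
Proof.
move=> /setIidPr UW; rewrite /gr_inv -big_split /=; apply: eq_bigr => i _.
by rewrite (big_setID U) /= UW.
Qed.

Lemma inv0l S : gr_inv set0 S = 0%N.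
Proof. by rewrite /gr_inv big_set0. Qed.

Lemma inv0r S : gr_inv S set0 = 0%N.
Proof. by rewrite /gr_inv big1 // => i _; rewrite big_set0. Qed.

Fact gr_mulA : associative gr_mul.
Proof.
move=> f g h; apply/ffunP => U; rewrite !ffunE.
under eq_bigr => S SU.
  rewrite ffunE mulr_sumr mulr_sumr.
  rewrite (reindex_onto (fun W : {set T} => W :\: S) (fun V => V :|: S)) /=.
    over.
  move=> V /subsetDP[_ dVS]; rewrite setDUl setDv setU0.
  by apply/setDidPl.
rewrite [RHS](eq_bigr (fun W : {set T} => \sum_(S : {set T} | S \subset W)
   gr_sign W (U :\: W) * (gr_sign S (W :\: S) * (f S * g (W :\: S))
      * h (U :\: W)))); last first.
  by move=> W WU; rewrite ffunE mulr_suml mulr_sumr.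
rewrite [RHS](exchange_big_dep (fun S : {set T} => S \subset U)) /=; last first.
  by move=> W S WU SW; apply: subset_trans WU.
apply: eq_bigr => S SU.
have UWS W : S \subset W -> U :\: S :\: (W :\: S) = U :\: W.
  move=> SW; apply/setP => z; rewrite !inE.
  by case: (boolP (z \in S)) => //= zS; rewrite (subsetP SW).
apply: eq_big => [W|W /andP[]].
  apply/andP/andP => [[] /subsetDP[H _] /eqP WE|[WU SW]].
    have SW : S \subset W by rewrite -WE subsetUr.
    split=> //; rewrite -(setID W S) (setIidPr SW) subUset SU /=.
    exact: H.
  rewrite setSD // setUC; split=> //; apply/eqP.
  by rewrite -[RHS](setID W S) (setIidPr SW).
move=> WU /eqP WE; have SW : S \subset W by rewrite -WE subsetUr.
have signE : gr_sign S (U :\: S) * gr_sign (W :\: S) (U :\: W)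
           = gr_sign W (U :\: W) * gr_sign S (W :\: S).
  rewrite /gr_sign -!exprD (inv_splitr S WU) UWS // (inv_splitl _ SW).
  by congr (_ ^+ _); rewrite -addnA addnC.
rewrite UWS // -!mulrA [gr_sign W _ * _]mulrA -signE -!mulrA.
by congr (_ * _); rewrite mulrCA.
Qed.

Lemma gr_mulE f g U : gr_mul f g U =
  \sum_(S : {set T} | S \subset U) gr_sign S (U :\: S) * (f S * g (U :\: S)).
Proof. by rewrite ffunE. Qed.

Fact gr_mul1l : left_id (gr_monom set0) gr_mul.
Proof.
move=> f; apply/ffunP => U; rewrite gr_mulE (bigD1 set0) ?sub0set //= setD0.
rewrite ffunE eqxx mul1r /gr_sign inv0l mul1r big1 ?addr0 // => S /andP[_ nS].
by rewrite ffunE (negPf nS) mul0r mulr0.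
Qed.

Fact gr_mul1r : right_id (gr_monom set0) gr_mul.
Proof.
move=> f; apply/ffunP => U; rewrite gr_mulE (bigD1 U) //= setDv.
rewrite ffunE eqxx mulr1 /gr_sign inv0r mul1r big1 ?addr0 // => S /andP[SU nS].
rewrite ffunE setD_eq0; case: (boolP (U \subset S)) => US; last by rewrite !mulr0.
by rewrite eqEsubset SU US in nS.
Qed.

Fact gr_mulDl : left_distributive gr_mul +%R.
Proof.
move=> f g h; apply/ffunP => U; rewrite !(ffunE, gr_mulE) -big_split /=.
by apply: eq_bigr => S _; rewrite ffunE mulrDl mulrDr.
Qed.

Fact gr_mulDr : right_distributive gr_mul +%R.
Proof.
move=> f g h; apply/ffunP => U; rewrite !(ffunE, gr_mulE) -big_split /=.
by apply: eq_bigr => S _; rewrite ffunE !mulrDr.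
Qed.

Fact gr_oner_neq0 : gr_monom set0 != 0.
Proof.
by apply/eqP => /ffunP/(_ set0); rewrite !ffunE eqxx => /eqP; rewrite oner_eq0.
Qed.

HB.instance Definition _ := GRing.Zmodule_isNzRing.Build E
  gr_mulA gr_mul1l gr_mul1r gr_mulDl gr_mulDr gr_oner_neq0.

Fact gr_scalerAl (c : K) f g : c *: (f * g) = (c *: f) * g.
Proof.
apply/ffunP => U; rewrite ffunE !gr_mulE scaler_sumr; apply: eq_bigr => S _.
by rewrite ffunE /GRing.scale /= -!mulrA mulrCA.
Qed.

HB.instance Definition _ := GRing.Lmodule_isLalgebra.Build K E gr_scalerAl.

Fact gr_scalerAr (c : K) f g : c *: (f * g) = f * (c *: g).
Proof.
apply/ffunP => U; rewrite ffunE !gr_mulE scaler_sumr; apply: eq_bigr => S _.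
rewrite ffunE /GRing.scale /= !mulrA; congr (_ * _).
by rewrite -mulrA mulrC.
Qed.

HB.instance Definition _ := GRing.Lalgebra_isAlgebra.Build K E gr_scalerAr.

HB.instance Definition _ := Algebra_isFalgebra.Build K E.

Lemma gr_monomM S U : gr_monom S * gr_monom U =
  if [disjoint S & U] then gr_sign S U *: gr_monom (S :|: U) else 0.
Proof.
apply/ffunP => V; rewrite gr_mulE.
have [SV|nSV] := boolP (S \subset V); last first.
  rewrite big1 => [|W WV].
    case: ifP; rewrite !ffunE // => _; case: eqP nSV => [->|]; last by rewrite scaler0.
    by rewrite subsetUl.
  by rewrite ffunE; case: eqP WV nSV => [-> ->|] //; rewrite mul0r mulr0.
rewrite (bigD1 S) //= big1 ?addr0 => [|W /andP[_ nW]]; last first.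
  by rewrite ffunE (negPf nW) mul0r mulr0.
rewrite !ffunE eqxx mul1r.
case: ifP => dSU; rewrite ffunE.
  rewrite ffunE; have -> : (V :\: S == U) = (V == S :|: U).
    apply/eqP/eqP => [<-|->]; first by rewrite -{1}(setID V S) (setIidPr SV).
    by rewrite setDUl setDv set0U; apply/setDidPl; rewrite disjoint_sym.
  case: eqP => [->|_]; last by rewrite mulr0 scaler0.
  congr (gr_sign _ _ * _); rewrite setDUl setDv set0U.
  by apply/setDidPl; rewrite disjoint_sym.
case: eqP dSU => [<-|_ _]; last by rewrite mulr0.
by rewrite -setI_eq0 setIDA setDIl setDv set0I eqxx.
Qed.

Lemma gr_genK x : gr_gen x * gr_gen x = 0.
Proof. by rewrite gr_monomM disjoints1 inE eqxx. Qed.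

Lemma gr_genC x y : gr_gen x * gr_gen y = - (gr_gen y * gr_gen x).
Proof.
have [->|nxy] := eqVneq x y; first by rewrite gr_genK oppr0.
rewrite !gr_monomM !disjoints1 !inE (negPf nxy) eq_sym (negPf nxy) /=.
rewrite /gr_sign /gr_inv !big_set1 setUC -scaleNr; congr (_ *: _).
case: (ltngtP (enum_rank x) (enum_rank y)) => [||/val_inj/enum_rank_inj xy].
- by rewrite expr1 opprK.
- by [].
by rewrite xy eqxx in nxy.
Qed.

Lemma gr_sum_genK : (\sum_x gr_gen x) * (\sum_x gr_gen x) = 0.
Proof.
rewrite mulr_suml; under eq_bigr do rewrite mulr_sumr.
pose rk x := enum_rank x.
under eq_bigr => x _ do
  rewrite (bigD1 x) //= gr_genK add0r (bigID (fun y => rk y < rk x)%N) /=.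
rewrite big_split /=.
rewrite [X in _ + X](exchange_big_dep predT) //= -big_split big1 //= => x _.
rewrite [X in _ + X](eq_bigr (fun y => - (gr_gen x * gr_gen y))); last first.
  by move=> y _; rewrite gr_genC.
rewrite sumrN; apply/eqP; rewrite subr_eq0; apply/eqP; apply: eq_bigl => y.
rewrite -leqNgt [x == y]eq_sym; case: eqVneq => //= nyx.
by rewrite ltn_neqAle (inj_eq val_inj) (inj_eq enum_rank_inj) nyx.
Qed.

End Grassmann.

Section VectQuotient.
Variables (K : fieldType) (V : vectType K) (U : {vspace V}).
Local Open Scope quotient_scope.

Definition vquot := Quotient.quot (pred_of_vspace U).

HB.instance Definition _ := GRing.Zmodule.on vquot.

Definition vpi (v : V) : vquot := \pi v.

Lemma vpi_eq u v : (vpi u == vpi v) = (u - v \in U).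
Proof. by rewrite /vpi -Quotient.idealrBE. Qed.

Lemma vpi_surj (q : vquot) : vpi (repr q) = q.
Proof. exact: reprK. Qed.

Lemma vpiD u v : vpi (u + v) = vpi u + vpi v.
Proof. exact: (raddfD (\pi_(Quotient.quot (pred_of_vspace U)))). Qed.

Lemma repr_vpi v : repr (vpi v) - v \in U.
Proof. by rewrite -vpi_eq vpi_surj. Qed.

Definition vquot_scale a (q : vquot) : vquot := vpi (a *: repr q).

Fact vquot_scale_vpi a v : vquot_scale a (vpi v) = vpi (a *: v).
Proof. by apply/eqP; rewrite vpi_eq -scalerBr memvZ ?repr_vpi. Qed.

Fact vquot_scaleA a b q :
  vquot_scale a (vquot_scale b q) = vquot_scale (a * b) q.
Proof. by rewrite -[q]vpi_surj !vquot_scale_vpi scalerA. Qed.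

Fact vquot_scale1 : left_id 1 vquot_scale.
Proof. by move=> q; rewrite -[q]vpi_surj vquot_scale_vpi scale1r. Qed.

Fact vquot_scaleDr : right_distributive vquot_scale +%R.
Proof.
move=> a q r; rewrite -[q]vpi_surj -[r]vpi_surj.
by rewrite -vpiD !vquot_scale_vpi scalerDr vpiD.
Qed.

Fact vquot_scaleDl q : {morph vquot_scale^~ q : a b / a + b}.
Proof. by move=> a b; rewrite /= /vquot_scale scalerDl vpiD. Qed.

HB.instance Definition _ := GRing.Zmodule_isLmodule.Build K vquot
  vquot_scaleA vquot_scale1 vquot_scaleDr vquot_scaleDl.

Fact vpi_is_linear : linear vpi.
Proof. by move=> a u v; rewrite vpiD -vquot_scale_vpi. Qed.

HB.instance Definition _ := GRing.isSemilinear.Build K V vquot _ vpi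
  (GRing.semilinear_linear vpi_is_linear).

Lemma vpi_eq0 v : (vpi v == 0) = (v \in U).
Proof. by rewrite -(raddf0 vpi) vpi_eq subr0. Qed.

Let W := (U^C)%VS.
Let toW (q : vquot) : V := daddv_pi W U (repr q).

Let WU0 : (W :&: U = 0)%VS. Proof. by rewrite capvC capv_compl. Qed.

Let toW_vpi v : toW (vpi v) = daddv_pi W U v.
Proof.
apply/eqP; rewrite -subr_eq0 -linearB /=.
have := daddv_pi_add (capv_compl U) (w := repr (vpi v) - v).
rewrite addv_complf memvf (daddv_pi_id (capv_compl U) (repr_vpi v)) => /(_ isT).
by move/eqP; rewrite -subr_eq0 addrAC subrr add0r.
Qed.

Let toWK q : vpi (toW q) = q.
Proof.
rewrite -{2}[q]vpi_surj; apply/eqP; rewrite vpi_eq.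
have := daddv_pi_add (capv_compl U) (w := repr q).
rewrite addv_complf memvf => /(_ isT) qE; rewrite -[X in _ - X]qE.
by rewrite /toW opprD addrCA subrr addr0 rpredN memv_pi.
Qed.

Fact vquot_vect_iso : Vector.axiom (\dim W) vquot.
Proof.
exists (fun q => \row_i coord (vbasis W) i (toW q)).
  move=> a q r; rewrite -[q]vpi_surj -[r]vpi_surj -(linearP vpi).
  by apply/rowP => i; rewrite !mxE !toW_vpi !linearP.
exists (fun rw : 'rV_(\dim W) => vpi (\sum_i rw 0 i *: (vbasis W)`_i)) => [q|rw].
  rewrite -[RHS]toWK; congr vpi; rewrite [RHS](coord_vbasis (memv_pi _ _ _)).
  by apply: eq_bigr => i _; rewrite mxE.
apply/rowP => i; rewrite mxE toW_vpi daddv_pi_id //.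
  by rewrite coord_sum_free ?(basis_free (vbasisP W)).
by apply: rpred_sum => j _; rewrite rpredZ ?vbasis_mem ?memt_nth.
Qed.

HB.instance Definition _ := Lmodule_hasFinDim.Build K vquot vquot_vect_iso.

End VectQuotient.

Section EdgeAlgebra.
Variables (K : fieldType) (G : sgraph).
Local Notation E := (grassmann K G).

Definition edge_ideal : {vspace E} :=
  (\sum_(e : G * G | adj e.1 e.2)
     ({:E} * <[gr_gen K e.1 * gr_gen K e.2]> * {:E}))%VS.

Lemma edge_ideal_edge x y :
  adj x y -> gr_gen K x * gr_gen K y \in edge_ideal.
Proof.
move=> xy; apply: (subvP (sumv_sup (x, y) _ (subvv _))) => //=.
by rewrite -[X in X \in _]mulr1 -[X in X * 1]mul1r !memv_mul ?memvf ?memv_line.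
Qed.

Lemma edge_idealMl f g : g \in edge_ideal -> f * g \in edge_ideal.
Proof.
suff: ({:E} * edge_ideal <= edge_ideal)%VS.
  by move=> /prodvP H /H; apply; rewrite ?memvf.
rewrite /edge_ideal big_distrr /=; apply/subv_sumP => e ee.
by rewrite !prodvA (sumv_sup e) // !prodvSl // subvf.
Qed.

Lemma edge_idealMr f g : f \in edge_ideal -> f * g \in edge_ideal.
Proof.
suff: (edge_ideal * {:E} <= edge_ideal)%VS.
  by move=> /prodvP H /H; apply; rewrite ?memvf.
rewrite /edge_ideal big_distrl /=; apply/subv_sumP => e ee.
by rewrite -prodvA (sumv_sup e) // prodvSr // subvf.
Qed.

Lemma edge_ideal_min (J : {vspace E}) :
    (forall f g, g \in J -> f * g \in J) ->
    (forall f g, f \in J -> f * g \in J) ->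
    (forall x y, adj x y -> gr_gen K x * gr_gen K y \in J) ->
  (edge_ideal <= J)%VS.
Proof.
move=> Jl Jr Jxy; apply/subv_sumP => e /Jxy Je.
apply/prodvP => u v Hu _; apply: Jr; move: u Hu; apply/subvP/prodvP => u w _.
by case/vlineP => c ->; rewrite -scalerAr memvZ // Jl.
Qed.

Fact edge_ideal1 : 1 \notin edge_ideal.
Proof.
have mul0 (f g : E) : (f * g) set0 = f set0 * g set0.
  rewrite gr_mulE (bigD1 set0) ?sub0set //= setD0 /gr_sign inv0l mul1r.
  by rewrite big1 ?addr0 // => S /andP[]; rewrite subset0 => /eqP->; rewrite eqxx.
have c_lin : linear (fun f : E => f set0 : K^o).
  by move=> a f g; rewrite !ffunE.
pose cM := GRing.isSemilinear.Build K E K^o _ _ (GRing.semilinear_linear c_lin).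
pose c : {linear E -> K^o} := HB.pack (fun f : E => f set0 : K^o) cM.
have kerE f : (f \in lker (linfun c)) = (f set0 == 0).
  by rewrite memv_ker lfunE.
have: (edge_ideal <= lker (linfun c))%VS.
  apply: edge_ideal_min => [f g|f g|x y _]; rewrite !kerE mul0.
  - by move=> /eqP->; rewrite mulr0.
  - by move=> /eqP->; rewrite mul0r.
  - by rewrite /gr_gen !ffunE [set0 == [set x]]eq_sym -cards_eq0 cards1 mul0r.
move/subvP/(_ 1)/contraNN; apply; rewrite kerE ffunE eqxx.
exact: oner_neq0.
Qed.

Definition edge_algebra := vquot edge_ideal.
Local Notation A := edge_algebra.

HB.instance Definition _ := Vector.on A.

Definition ea_pi (f : E) : A := @vpi K E edge_ideal f.
Local Notation p := ea_pi.

Definition ea_mul (u v : A) : A := p (repr u * repr v).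

Fact ea_mulE f g : ea_mul (p f) (p g) = p (f * g).
Proof.
apply/eqP; rewrite vpi_eq.
rewrite -(subrKA (f * repr (p g))) -mulrBl -mulrBr rpredD //.
  by rewrite edge_idealMr // repr_vpi.
by rewrite edge_idealMl // repr_vpi.
Qed.

Let pK u : p (repr u) = u. Proof. exact: vpi_surj. Qed.
Let pD f g : p (f + g) = p f + p g. Proof. exact: vpiD. Qed.
Let pZ c f : p (c *: f) = c *: p f. Proof. exact: linearZ. Qed.

Fact ea_mulA : associative ea_mul.
Proof. by move=> u v w; rewrite -[u]pK -[v]pK -[w]pK !ea_mulE mulrA. Qed.

Fact ea_mul1l : left_id (p 1) ea_mul.
Proof. by move=> u; rewrite -[u]pK ea_mulE mul1r. Qed.

Fact ea_mul1r : right_id (p 1) ea_mul.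
Proof. by move=> u; rewrite -[u]pK ea_mulE mulr1. Qed.

Fact ea_mulDl : left_distributive ea_mul +%R.
Proof.
by move=> u v w; rewrite -[u]pK -[v]pK -[w]pK -pD !ea_mulE mulrDl pD.
Qed.

Fact ea_mulDr : right_distributive ea_mul +%R.
Proof.
by move=> u v w; rewrite -[u]pK -[v]pK -[w]pK -pD !ea_mulE mulrDr pD.
Qed.

Fact ea_oner_neq0 : p 1 != 0.
Proof. by rewrite vpi_eq0 edge_ideal1. Qed.

HB.instance Definition _ := GRing.Zmodule_isNzRing.Build A
  ea_mulA ea_mul1l ea_mul1r ea_mulDl ea_mulDr ea_oner_neq0.

Let pM f g : p f * p g = p (f * g). Proof. exact: ea_mulE. Qed.

Fact ea_scalerAl (c : K) (u v : A) : c *: (u * v) = (c *: u) * v.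
Proof.
by rewrite -[u]pK -[v]pK pM -!pZ pM scalerAl.
Qed.

HB.instance Definition _ := GRing.Lmodule_isLalgebra.Build K A ea_scalerAl.

Fact ea_scalerAr (c : K) (u v : A) : c *: (u * v) = u * (c *: v).
Proof.
by rewrite -[u]pK -[v]pK pM -!pZ pM scalerAr.
Qed.

HB.instance Definition _ := GRing.Lalgebra_isAlgebra.Build K A ea_scalerAr.

HB.instance Definition _ := Algebra_isFalgebra.Build K A.

Definition ea_gen (x : G) : A := p (gr_gen K x).

Definition ea_diff : 'End(A) := amull (\sum_(x : G) ea_gen x).

Lemma ea_diffK u : ea_diff (ea_diff u) = 0.
Proof.
rewrite /ea_diff /amull !lfunE /= mulrA; set s := \sum_x _.
suff -> : s * s = 0 by rewrite mul0r.
have -> : s = p (\sum_x gr_gen K x) by rewrite /ea_pi linear_sum.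
by rewrite pM gr_sum_genK /ea_pi linear0.
Qed.

End EdgeAlgebra.

(* ker D / im D; the preimage of limg D restricts im D to ker D. *)
Definition homology (K : fieldType) (V : vectType K) (D : 'End(V)) :=
  vquot (linfun (vsval : subvs_of (lker D) -> V) @^-1: limg D)%VS.

Section DirectSum.
Variables (K : fieldType) (I : finType) (V : I -> lmodType K).

(* I is finite, so the direct sum is the set of all families. *)
Definition dirsum := {dffun forall i, V i}.
Implicit Types f g h : dirsum.

HB.instance Definition _ := Choice.on dirsum.

Definition ds_zero : dirsum := [ffun i => 0 : V i].
Definition ds_opp f : dirsum := [ffun i => - f i].
Definition ds_add f g : dirsum := [ffun i => f i + g i].
Definition ds_scale (a : K) f : dirsum := [ffun i => a *: f i].

Fact ds_addA : associative ds_add.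
Proof. by move=> f g h; apply/ffunP => i; rewrite !ffunE addrA. Qed.
Fact ds_addC : commutative ds_add.
Proof. by move=> f g; apply/ffunP => i; rewrite !ffunE addrC. Qed.
Fact ds_add0 : left_id ds_zero ds_add.
Proof. by move=> f; apply/ffunP => i; rewrite !ffunE add0r. Qed.
Fact ds_addN : left_inverse ds_zero ds_opp ds_add.
Proof. by move=> f; apply/ffunP => i; rewrite !ffunE addNr. Qed.

HB.instance Definition _ :=
  GRing.isZmodule.Build dirsum ds_addA ds_addC ds_add0 ds_addN.

Fact ds_scaleA a b f : ds_scale a (ds_scale b f) = ds_scale (a * b) f.
Proof. by apply/ffunP => i; rewrite !ffunE scalerA. Qed.
Fact ds_scale1 : left_id 1 ds_scale.
Proof. by move=> f; apply/ffunP => i; rewrite !ffunE scale1r. Qed.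
Fact ds_scaleDr : right_distributive ds_scale +%R.
Proof. by move=> a f g; apply/ffunP => i; rewrite !ffunE scalerDr. Qed.
Fact ds_scaleDl f : {morph ds_scale^~ f : a b / a + b}.
Proof. by move=> a b; apply/ffunP => i; rewrite !ffunE scalerDl. Qed.

HB.instance Definition _ := GRing.Zmodule_isLmodule.Build K dirsum
  ds_scaleA ds_scale1 ds_scaleDr ds_scaleDl.

End DirectSum.

Definition HA (K : fieldType) (G : sgraph) : vectType K :=
  homology (ea_diff K G).

(* Main.v *)
Require Import Defs.
From HB Require Import structures.
From mathcomp Require Import all_boot all_order all_algebra all_field.

Set Implicit Arguments.
Unset Strict Implicit.
Unset Printing Implicit Defensive.

Import GRing.Theory.
Local Open Scope ring_scope.

(* Write D for multiplication by the sum of all generators and d_y for the    *)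
(* contraction by y, so that d_y D + D d_y = 1. Since N[x] = {x, a_1, .., a_n} *)
(* is a clique, an independent set meets it in at most one vertex. The maps    *)
(* Psi_i = (d_{a_i} - d_x followed by restriction to G_i) and                  *)
(* Phi_i = (multiplication by a_i) anticommute with D, satisfy                 *)
(* Psi_j Phi_i = delta_ij, and 1 - sum_i Phi_i Psi_i = D h + h D on A_G, where *)
(* h is d_x followed by killing the generators in N[x]. Hence the Psi_i induce *)
(* the isomorphism in homology.                                               *)

(** Modulo the edge ideal, an element of the Grassmann algebra is determined by its coefficients on
    independent sets ([edge_idealP]), so identities in A_G are checked coefficientwise there. On the
    whole Grassmann algebra, contraction by x is a contracting homotopy for D ([gr_contr_sumM]), but
    it does not descend to A_G: adding x to an independent set may create an edge. Truncated to sets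
    that avoid the closed neighbourhood of x, it does descend ([gr_homotopy]), and it fails to
    contract only on independent sets containing some a_i. Such a set is a_i together with an
    independent set of G_i, so the defect factors through the algebras of the G_i. This makes their
    direct sum, shifted by one degree and with negated differentials, a deformation retract of A_G
    ([gr_homotopyP]); total homology ignores the shift, and [homology_dirsum] concludes. *)

Section Contraction.
Variables (K : fieldType) (T : finType).
Local Notation E := (grassmann K T).
Implicit Types (f g : E) (y z : T) (U : {set T}).

Definition gr_sum : E := \sum_y gr_gen K y.

Lemma gr_sign_sq (U W : {set T}) : gr_sign K U W * gr_sign K U W = 1.
Proof. by rewrite -expr2 sqrr_sign. Qed.

Lemma gr_sign1_swap y z :
  y != z -> gr_sign K [set y] [set z] * gr_sign K [set z] [set y] = -1.
Proof.
move=> nyz; rewrite /gr_sign /gr_inv !big_set1 -exprD.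
case: (ltngtP (enum_rank y) (enum_rank z)) => [||/val_inj/enum_rank_inj yz] //.
by rewrite yz eqxx in nyz.
Qed.

Lemma gr_sign_splitr (S U W : {set T}) :
  U \subset W -> gr_sign K S W = gr_sign K S U * gr_sign K S (W :\: U).
Proof. by move=> UW; rewrite /gr_sign (inv_splitr S UW) exprD. Qed.

Lemma gr_sign1U y z U : z \notin U ->
  gr_sign K [set y] (z |: U) = gr_sign K [set y] [set z] * gr_sign K [set y] U.
Proof.
by move=> zU; rewrite (@gr_sign_splitr _ [set z]) ?setU1K // sub1set setU11.
Qed.

Lemma gr_subE f g U : (f - g) U = f U - g U.
Proof. by rewrite !ffunE. Qed.

Lemma gr_monom_decomp f : f = \sum_U f U *: gr_monom K U.
Proof.
apply/ffunP => U; rewrite sum_ffunE (bigD1 U) //= !ffunE eqxx.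
rewrite big1 ?addr0 => [|W nW]; first by rewrite /GRing.scale /= mulr1.
by rewrite !ffunE eq_sym (negPf nW) scaler0.
Qed.

Lemma gr_genME y f U : (gr_gen K y * f) U =
  if y \in U then gr_sign K [set y] (U :\ y) * f (U :\ y) else 0.
Proof.
rewrite gr_mulE; case: ifPn => yU.
  rewrite (bigD1 [set y]) ?sub1set //= ffunE eqxx mul1r big1 ?addr0 //.
  by move=> S /andP[_ nS]; rewrite ffunE (negPf nS) mul0r mulr0.
rewrite big1 // => S SU; rewrite ffunE; case: eqP SU => [->|_].
  by rewrite sub1set (negPf yU).
by rewrite mul0r mulr0.
Qed.

(* The antiderivation of the Grassmann algebra dual to the generator y. *)
Definition gr_contr y f : E :=
  [ffun U : {set T} => if y \in U then 0 else gr_sign K [set y] U * f (y |: U)].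

Lemma gr_contrE y f U : gr_contr y f U =
  if y \in U then 0 else gr_sign K [set y] U * f (y |: U).
Proof. by rewrite ffunE. Qed.

Lemma gr_contr_is_linear y : linear (gr_contr y).
Proof.
move=> c f g; apply/ffunP => U; rewrite !ffunE; case: ifP => _.
  by rewrite scaler0 addr0.
by rewrite /GRing.scale /= mulrDr mulrCA.
Qed.

HB.instance Definition _ y := GRing.isSemilinear.Build K E E _ (gr_contr y)
  (GRing.semilinear_linear (gr_contr_is_linear y)).

(** The canonical anticommutation relation. For [y != z] the minus sign is that of exchanging two
    generators ([gr_sign1_swap]). *)
Lemma gr_contr_genM y z f :
  gr_contr z (gr_gen K y * f) = f *+ (y == z) - gr_gen K y * gr_contr z f.
Proof.
apply/ffunP => U; rewrite gr_contrE gr_subE !gr_genME gr_contrE.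
have [->|nyz] := eqVneq y z; rewrite ?mulr1n ?mulr0n.
  rewrite setU11; have [zU|zU] := ifPn; last first.
    by rewrite setU1K // mulrA gr_sign_sq mul1r subr0.
  by rewrite !inE eqxx /= setD1K // mulrA gr_sign_sq mul1r subrr.
rewrite !inE (negPf nyz) [z == y]eq_sym (negPf nyz) /= ffunE add0r.
have [zU|zU] := ifPn; have [yU|yU] := ifPn; rewrite ?mulr0 ?oppr0 //.
have -> : (z |: U) :\ y = z |: (U :\ y).
  by apply/setP => w; rewrite !inE; have [->|] := eqVneq w z; rewrite // andbT eq_sym nyz.
rewrite -{1}(setD1K yU) !gr_sign1U ?inE ?eqxx ?(negPf zU) ?andbF //.
rewrite !mulrA -mulNr; congr (_ * _).
rewrite -[_ * gr_sign K [set y] [set z] * _]mulrA mulrACA gr_sign1_swap 1?eq_sym //.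
by rewrite mulN1r mulrC.
Qed.

(** Summing the anticommutation relations over all generators leaves a single [f], from the
    generator [z] itself; hence every contraction is a contracting homotopy before passing to the
    quotient. *)
Lemma gr_contr_sumM z f :
  gr_contr z (gr_sum * f) = f - gr_sum * gr_contr z f.
Proof.
rewrite mulr_suml linear_sum /=.
under eq_bigr do rewrite gr_contr_genM.
rewrite sumrB -mulr_suml; congr (_ - _).
by rewrite (bigD1 z) //= eqxx big1 ?addr0 // => y /negPf->.
Qed.

Lemma gr_genM_contr y f U : y \in U -> (gr_gen K y * gr_contr y f) U = f U.
Proof.
move=> yU; rewrite gr_genME yU gr_contrE setD11 setD1K //.
by rewrite mulrA gr_sign_sq mul1r.
Qed.

Lemma gr_sum_genC y : gr_sum * gr_gen K y = - (gr_gen K y * gr_sum).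
Proof.
by rewrite mulr_suml mulr_sumr -sumrN; apply: eq_bigr => z _; apply: gr_genC.
Qed.

End Contraction.

(** * Independent sets and the edge ideal *)

Section Independent.
Variables (K : fieldType) (G : sgraph).
Local Notation E := (grassmann K G).
Implicit Types (f g : E) (S U : {set G}).

Definition independent S := [forall y in S, forall z in S, ~~ adj y z].

Lemma independentP S :
  reflect {in S &, forall y z, ~~ adj y z} (independent S).
Proof.
apply: (iffP forall_inP) => [H y z /H/forall_inP|H y yS]; first exact.
by apply/forall_inP => z; apply: H.
Qed.

Lemma independentS S U : S \subset U -> independent U -> independent S.
Proof.
move=> /subsetP SU /independentP iU; apply/independentP => y z yS zS.
by apply: iU; apply: SU.
Qed.

(** The ideal is spanned by the monomials of dependent sets: their span is an ideal containing the
    edge products, and conversely such a monomial is divisible by an edge product. *)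
Lemma edge_idealP f :
  reflect (forall S, independent S -> f S = 0) (f \in edge_ideal K G).
Proof.
apply: (iffP idP) => [fI S iS | fz].
  pose J : {vspace E} := (\sum_(U | ~~ independent U) <[gr_monom K U]>)%VS.
  have JP g : g \in J -> forall S, independent S -> g S = 0.
    case/memv_sumP => v vU -> W iW; rewrite sum_ffunE big1 // => U nU.
    have /vlineP[c ->] := vU U nU.
    rewrite !ffunE; case: eqP => [WU|_]; last by rewrite scaler0.
    by rewrite -WU iW in nU.
  have gJ g : (forall S, independent S -> g S = 0) -> g \in J.
    move=> gz; rewrite [g]gr_monom_decomp; apply: rpred_sum => U _.
    case: (boolP (independent U)) => [/gz->|nU].
      by rewrite scale0r mem0v.
    by rewrite rpredZ // (subvP (sumv_sup U nU (subvv _))) // memv_line.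
  suff: (edge_ideal K G <= J)%VS by move/subvP/(_ _ fI)/JP; apply.
  apply: edge_ideal_min => [g h /JP hz|g h /JP gz|y z yz]; apply: gJ => U iU.
  - rewrite gr_mulE big1 // => W WU.
    by rewrite hz ?mulr0 // (independentS _ iU) ?subsetDl.
  - by rewrite gr_mulE big1 // => W WU; rewrite gz ?mul0r ?mulr0 // (independentS WU iU).
  - rewrite gr_genME ffunE; case: ifP => // yU; case: eqP => [Uz|]; last by rewrite mulr0.
    have zU : z \in U.
      by have /setD1P[] : z \in U :\ y by rewrite Uz inE.
    by have /independentP/(_ y z yU zU) := iU; rewrite yz.
rewrite [f]gr_monom_decomp; apply: rpred_sum => U _.
case: (boolP (independent U)) => [/fz->|nU].
  by rewrite scale0r mem0v.
rewrite rpredZ //.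
have /existsP[y /existsP[z /and3P[yU zU yz]]] :
    [exists y, exists z, [&& y \in U, z \in U & adj y z]].
  apply: contraR nU => /existsPn H; apply/independentP => y z yU zU.
  by have /existsPn/(_ z) := H y; rewrite yU zU.
have nyz : y != z by apply: contraTneq yz => ->; rewrite adj_irrefl.
have zUy : z \in U :\ y by rewrite !inE eq_sym nyz.
(* e_U = +/- x_y x_z e_(U \ {y, z}) *)
have -> : gr_monom K U = (gr_sign K [set y] (U :\ y) * gr_sign K [set z] (U :\ y :\ z))
    *: (gr_gen K y * gr_gen K z * gr_monom K (U :\ y :\ z)).
  rewrite -mulrA /gr_gen gr_monomM disjoints1 !inE eqxx /= setD1K // -scalerAr.
  rewrite gr_monomM disjoints1 !inE eqxx /= setD1K // !scalerA.
  rewrite -mulrA [gr_sign K [set z] _ * _]mulrC mulrACA.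
  by rewrite !gr_sign_sq mulr1 scale1r.
by rewrite rpredZ // edge_idealMr // edge_ideal_edge.
Qed.

End Independent.

(** * Homology classes and deformation retracts *)

Section Homology.
Variable K : fieldType.

Section HomologyClass.
Variables (V : vectType K) (D : 'End(V)).

(** Projecting to the kernel first makes the class map linear on all of [V]; it has its usual
    meaning on cycles only. *)
Definition hclass (v : V) : homology D := vpi _ (vsproj (lker D) v).

Lemma hclass_is_linear : linear hclass.
Proof. by move=> c u v; rewrite /hclass !linearP. Qed.

HB.instance Definition _ := GRing.isSemilinear.Build K V (homology D) _ hclass
  (GRing.semilinear_linear hclass_is_linear).

Lemma hclass_eq0 v : v \in lker D -> (hclass v == 0) = (v \in limg D).
Proof. by move=> vD; rewrite vpi_eq0 -memv_preim lfunE /= vsprojK. Qed.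

Definition hrepr (q : homology D) : V := vsval (repr q).

Lemma hrepr_ker q : hrepr q \in lker D.
Proof. exact: subvsP. Qed.

Lemma hreprK : cancel hrepr hclass.
Proof. by move=> q; rewrite /hclass /hrepr vsvalK vpi_surj. Qed.

Lemma hrepr_class v : v \in lker D -> hrepr (hclass v) - v \in limg D.
Proof.
move=> vD; rewrite -hclass_eq0 ?rpredB ?hrepr_ker //.
by rewrite linearB /= hreprK subrr.
Qed.

End HomologyClass.

(** Anticommuting maps preserve cycles and boundaries just as chain maps do. The sum of the [Phi i]
    inverts the family [Psi] on one side exactly, and on the other side up to the homotopy [h]. *)
Lemma homology_dirsum (V : vectType K) (D : 'End(V)) (I : finType)
    (W : I -> vectType K) (DW : forall i, 'End(W i))
    (Psi : forall i, {linear V -> W i}) (Phi : forall i, {linear W i -> V})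
    (h : {linear V -> V}) :
    (forall i v, DW i (Psi i v) = - Psi i (D v)) ->
    (forall i w, D (Phi i w) = - Phi i (DW i w)) ->
    (forall i w, Psi i (Phi i w) = w) ->
    (forall i j w, i != j -> Psi j (Phi i w) = 0) ->
    (forall v, v - \sum_i Phi i (Psi i v) = D (h v) + h (D v)) ->
  exists f : {linear homology D -> dirsum (fun i => homology (DW i))},
    bijective f.
Proof.
move=> PsiD PhiD PsiPhi PsiPhi0 Dh.
have Psi_ker i v : v \in lker D -> Psi i v \in lker (DW i).
  by rewrite !memv_ker PsiD => /eqP->; rewrite linear0 oppr0.
have Phi_ker i w : w \in lker (DW i) -> Phi i w \in lker D.
  by rewrite !memv_ker PhiD => /eqP->; rewrite linear0 oppr0.
have Psi_img i v : v \in limg D -> Psi i v \in limg (DW i).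
  case/memv_imgP => u _ ->; rewrite -[Psi i _]opprK -PsiD rpredN.
  by rewrite memv_img ?memvf.
have Phi_img i w : w \in limg (DW i) -> Phi i w \in limg D.
  case/memv_imgP => u _ ->; rewrite -[Phi i _]opprK -PhiD rpredN.
  by rewrite memv_img ?memvf.
have classW i v w : v \in lker D -> w \in lker D -> v - w \in limg D ->
    hclass (DW i) (Psi i v) = hclass (DW i) (Psi i w).
  move=> vD wD vw; apply/eqP; rewrite -subr_eq0 -!linearB /=.
  by rewrite hclass_eq0 ?Psi_img // Psi_ker // rpredB.
pose F (q : homology D) : dirsum (fun i => homology (DW i)) :=
  [ffun i => hclass (DW i) (Psi i (hrepr q))].
have F_lin : linear F.
  move=> c q r; apply/ffunP => i; rewrite !ffunE -!linearP /=.
  apply: classW; [exact: hrepr_ker | by rewrite rpredD ?rpredZ ?hrepr_ker |].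
  have -> : c *: q + r = hclass D (c *: hrepr q + hrepr r).
    by rewrite linearP /= !hreprK.
  by rewrite hrepr_class // rpredD ?rpredZ ?hrepr_ker.
pose FM := GRing.isSemilinear.Build K _ _ _ F (GRing.semilinear_linear F_lin).
pose f : {linear homology D -> dirsum (fun i => homology (DW i))} := HB.pack F FM.
pose g (w : dirsum (fun i => homology (DW i))) : homology D :=
  hclass D (\sum_i Phi i (hrepr (w i))).
have sum_ker (w : forall i, W i) :
    (forall i, w i \in lker (DW i)) -> \sum_i Phi i (w i) \in lker D.
  by move=> wD; apply: rpred_sum => i _; apply: Phi_ker.
exists f; exists g => [q|w]; rewrite /f /= /F /g.
  apply/eqP; rewrite -{2}[q]hreprK eq_sym -subr_eq0 -linearB /=.
  set v := hrepr q; have vD : v \in lker D by apply: hrepr_ker.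
  rewrite hclass_eq0; last first.
    by rewrite rpredB // sum_ker // => i; apply: hrepr_ker.
  have Dv : D v = 0 by apply/eqP; rewrite -memv_ker.
  (* As [v] is a cycle, the homotopy formula leaves the boundary [D (h v)]; what remains comes from
     the choice of representatives and is a boundary too. *)
  rewrite -[X in X - _](subrK (\sum_i Phi i (Psi i v))) Dh Dv linear0 addr0 -addrA.
  rewrite rpredD ?memv_img ?memvf // -sumrB rpred_sum // => i _.
  rewrite -linearB /= Phi_img // ffunE -rpredN opprB hrepr_class //.
  exact: Psi_ker.
apply/ffunP => i; rewrite ffunE.
rewrite -[RHS]hreprK; set u := \sum_j _.
have uD : u \in lker D by apply: sum_ker => j; apply: hrepr_ker.
rewrite (classW i _ u) ?hrepr_ker ?hrepr_class //; congr hclass.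
rewrite linear_sum (bigD1 i) //= PsiPhi big1 ?addr0 // => j ji.
by rewrite PsiPhi0.
Qed.

End Homology.

(** * Linear maps induced on quotients *)

Section QuotientLift.
Variables (K : fieldType) (V V' : vectType K) (U : {vspace V}) (U' : {vspace V'}).
Variables (F : {linear V -> V'}) (FU : forall u, u \in U -> F u \in U').

(* The proof argument is a phantom: it makes linearity a canonical instance. *)
Definition vquot_lift of (forall u, u \in U -> F u \in U') :=
  fun q : vquot U => vpi U' (F (repr q)).

Lemma vquot_liftE v : vquot_lift FU (vpi U v) = vpi U' (F v).
Proof. by apply/eqP; rewrite vpi_eq -linearB FU ?repr_vpi. Qed.

Lemma vquot_lift_is_linear : linear (vquot_lift FU).
Proof.
move=> c q r; rewrite -[q]vpi_surj -[r]vpi_surj -linearP.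
by rewrite !vquot_liftE !linearP.
Qed.

HB.instance Definition _ := GRing.isSemilinear.Build K (vquot U) (vquot U') _
  (vquot_lift FU) (GRing.semilinear_linear vquot_lift_is_linear).

End QuotientLift.

Lemma index_filter_ltn (I : eqType) (P : pred I) (s : seq I) (y z : I) : P y -> P z ->
  (index y (filter P s) < index z (filter P s))%N = (index y s < index z s)%N.
Proof.
move=> Py Pz; elim: s => //= w s IHs; case: ifPn => [Pw|nPw] /=.
  by case: (w == y); case: (w == z); rewrite ?ltnS.
have /negPf-> : w != y by apply: contraNneq nPw => ->.
have /negPf-> : w != z by apply: contraNneq nPw => ->.
by rewrite ltnS.
Qed.

Lemma enum_rank_index (I : finType) (y : I) : enum_rank y = index y (enum I) :> nat.
Proof.
rewrite -{2}[y]enum_rankK (enum_val_nth y) index_uniq ?enum_uniq //.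
by rewrite -cardE ltn_ord.
Qed.

(** * Restriction to the graph with the vertices of [S] deleted *)

Section Restriction.
Variables (K : fieldType) (G : sgraph) (S : {set G}).
Implicit Types (f : grassmann K G) (g : grassmann K (del S)).
Implicit Types (d : del S) (T : {set del S}) (U : {set G}).

Definition del_val d : G := val (d : {y : G | y \notin S}).

Lemma del_val_inj : injective del_val.
Proof. exact: val_inj. Qed.

Lemma del_valP d : del_val d \notin S.
Proof. exact: (valP (d : {y : G | y \notin S})). Qed.

Lemma del_val_notin T y : y \in S -> y \notin del_val @: T.
Proof.
by move=> yS; apply/imsetP => -[d _ yd]; rewrite yd (negPf (del_valP d)) in yS.
Qed.

Lemma del_val_preimK U : [disjoint U & S] -> del_val @: (del_val @^-1: U) = U.
Proof.
move=> US; apply/setP => y; apply/imsetP/idP => [[d]|yU]; first by rewrite inE => ? ->.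
by exists (exist _ y (negbT (disjointFr US yU)) : del S); rewrite ?inE.
Qed.

(* Deletion keeps the order on the remaining vertices, hence all signs. *)
Lemma enum_rank_del_val d1 d2 :
  (enum_rank (del_val d1) < enum_rank (del_val d2))%N = (enum_rank d1 < enum_rank d2)%N.
Proof.
rewrite !enum_rank_index -!(index_map del_val_inj (enum (del S))).
have -> : map del_val (enum (del S)) = filter (fun y => y \notin S) (enum G).
  rewrite [in LHS]enumT unlock /= pmap_filter; last exact: insubK.
  by rewrite -enumT; apply: eq_filter => y; apply: isSome_insub.
by rewrite [RHS]index_filter_ltn //; apply: del_valP.
Qed.

Lemma gr_sign_del_val d T :
  gr_sign K [set del_val d] (del_val @: T) = gr_sign K [set d] T.
Proof.
rewrite /gr_sign /gr_inv !big_set1 big_imset /=; last by move=> ? ? _ _ /del_val_inj.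
by under eq_bigr do rewrite enum_rank_del_val.
Qed.

Lemma independent_del_val T : independent (del_val @: T) = independent T.
Proof.
apply/independentP/independentP => [iT y z yT zT|iT _ _ /imsetP[y yT ->] /imsetP[z zT ->]].
  exact: (iT (del_val y) (del_val z) (imset_f _ yT) (imset_f _ zT)).
exact: iT.
Qed.

(* The algebra morphism sending the deleted generators to zero. *)
Definition gr_res f : grassmann K (del S) := [ffun T : {set del S} => f (del_val @: T)].

Lemma gr_resE f T : gr_res f T = f (del_val @: T).
Proof. by rewrite ffunE. Qed.

Lemma gr_res_is_linear : linear gr_res.
Proof. by move=> c f1 f2; apply/ffunP => T; rewrite !ffunE. Qed.

HB.instance Definition _ := GRing.isSemilinear.Build K (grassmann K G)
  (grassmann K (del S)) _ gr_res (GRing.semilinear_linear gr_res_is_linear).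

(** A linear section of [gr_res], not extension by zero: elements of [S] in [U] are ignored. Any
    section would serve, since [gr_genM_ideal] makes its choice invisible in A_G. *)
Definition gr_ext g : grassmann K G := [ffun U : {set G} => g (del_val @^-1: U)].

Lemma gr_ext_is_linear : linear gr_ext.
Proof. by move=> c g1 g2; apply/ffunP => U; rewrite !ffunE. Qed.

HB.instance Definition _ := GRing.isSemilinear.Build K (grassmann K (del S))
  (grassmann K G) _ gr_ext (GRing.semilinear_linear gr_ext_is_linear).

Lemma gr_extK : cancel gr_ext gr_res.
Proof.
move=> g; apply/ffunP => T; rewrite !ffunE; congr (g _).
by apply/setP => d; rewrite !inE mem_imset //; apply: del_val_inj.
Qed.

Lemma gr_res_genM_del y f : y \in S -> gr_res (gr_gen K y * f) = 0.
Proof.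
move=> yS; apply/ffunP => T.
by rewrite gr_resE gr_genME (negPf (del_val_notin T yS)) ffunE.
Qed.

Lemma gr_res_genM d f : gr_res (gr_gen K (del_val d) * f) = gr_gen K d * gr_res f.
Proof.
apply/ffunP => T; rewrite gr_resE !gr_genME (mem_imset _ _ del_val_inj) gr_resE.
have E : del_val @: (T :\ d) = del_val @: T :\ del_val d.
  apply/setP => y; apply/imsetP/setD1P => [[e /setD1P[ed eT] ->]|[yd /imsetP[e eT ye]]].
    by rewrite imset_f // (inj_eq del_val_inj).
  by exists e => //; rewrite !inE eT andbT; apply: contraNneq yd => <-; rewrite ye.
by rewrite -gr_sign_del_val E.
Qed.

Lemma gr_res_sumM f : gr_res (gr_sum K G * f) = gr_sum K (del S) * gr_res f.
Proof.
rewrite mulr_suml linear_sum (bigID (mem S)) /= big1 ?add0r => [|y yS]; last first.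
  exact: gr_res_genM_del.
rewrite mulr_suml (big_sub (fun y => y \notin S)) /=.
by apply: eq_bigr => d _; rewrite -gr_res_genM.
Qed.

End Restriction.

Arguments del_val {G S} d.

(** * The maps between A_G and the algebra of G without a closed neighbourhood *)

Section Link.
Variables (K : fieldType) (G : sgraph).
Implicit Types (f : grassmann K G) (c y : G) (T U : {set G}).
Local Notation star c := (c |: nbhd c).

Lemma ea_diffE f : ea_diff K G (ea_pi f) = ea_pi (gr_sum K G * f).
Proof.
rewrite lfunE /=; have -> : \sum_y ea_gen K y = ea_pi (gr_sum K G).
  by rewrite /ea_pi linear_sum.
exact: ea_mulE.
Qed.

Lemma independent1U y T :
  independent T -> [disjoint T & star y] -> independent (y |: T).
Proof.
move=> /independentP iT Ty; have nyT z : z \in T -> ~~ adj y z.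
  by move=> zT; have := disjointFr Ty zT; rewrite !inE => /norP[].
apply/independentP => w z /setU1P[->|wT] /setU1P[->|zT]; rewrite ?adj_irrefl ?nyT //.
  by rewrite adj_sym nyT.
exact: iT.
Qed.

Lemma independent_star y U :
  independent U -> y \in U -> [disjoint U :\ y & star y].
Proof.
move=> /independentP iU yU; rewrite disjoint_subset; apply/subsetP => z /setD1P[zy zU].
by rewrite !inE (negPf zy) /= iU.
Qed.

Lemma gr_contr_ideal_eq0 y f T : f \in edge_ideal K G -> independent T ->
  [disjoint T & star y] -> gr_contr y f T = 0.
Proof.
move=> /edge_idealP fI iT Ty; rewrite gr_contrE fI ?mulr0 ?if_same //.
exact: independent1U.
Qed.

(* In A_G the product x_c f depends only on f modulo the closed neighbourhood of c. *)
Lemma gr_genM_ideal c f : gr_res (star c) f \in edge_ideal K (del (star c)) ->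
  gr_gen K c * f \in edge_ideal K G.
Proof.
move=> /edge_idealP fI; apply/edge_idealP => U iU; rewrite gr_genME; case: ifP => // cU.
rewrite -(del_val_preimK (independent_star iU cU)) -gr_resE fI ?mulr0 //.
rewrite -independent_del_val del_val_preimK ?independent_star //.
exact: independentS (subD1set _ _) iU.
Qed.

Definition gr_join c (g : grassmann K (del (star c))) : grassmann K G :=
  gr_gen K c * gr_ext g.

Lemma gr_join_is_linear c : linear (@gr_join c).
Proof. by move=> k g1 g2; rewrite /gr_join linearP mulrDr scalerAr. Qed.

HB.instance Definition _ c := GRing.isSemilinear.Build K
  (grassmann K (del (star c))) (grassmann K G) _ (@gr_join c)
  (GRing.semilinear_linear (@gr_join_is_linear c)).

Lemma gr_join_ideal c g :
  g \in edge_ideal K (del (star c)) -> gr_join g \in edge_ideal K G.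
Proof. by move=> gI; apply: gr_genM_ideal; rewrite gr_extK. Qed.

(** Moving D past the generator [c] costs a sign, and the leftover factor restricts to zero off
    [star c], since [gr_res] intertwines the two differentials. *)
Lemma gr_join_sumM c (g : grassmann K (del (star c))) :
  gr_sum K G * gr_join g + gr_join (gr_sum K _ * g) \in edge_ideal K G.
Proof.
rewrite /gr_join mulrA gr_sum_genC mulNr addrC -mulrA -mulrBr.
apply: gr_genM_ideal.
by rewrite linearB /= gr_res_sumM !gr_extK subrr mem0v.
Qed.

Section Vertex.
Variable x : G.

(** Subtracting the contraction by [x] cancels the term [f] in [gr_contr_sumM], so that the
    difference anticommutes with D. *)
Definition gr_link c f : grassmann K (del (star c)) :=
  gr_res (star c) (gr_contr c f - gr_contr x f).

Lemma gr_link_is_linear c : linear (gr_link c).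
Proof.
move=> k f1 f2; rewrite /gr_link -[RHS]linearP; congr (gr_res _ _).
by rewrite [gr_contr c _]linearP [gr_contr x _]linearP /= scalerBr opprD addrACA.
Qed.

HB.instance Definition _ c := GRing.isSemilinear.Build K (grassmann K G)
  (grassmann K (del (star c))) _ (gr_link c)
  (GRing.semilinear_linear (gr_link_is_linear c)).

Lemma gr_link_sumM c f : gr_link c (gr_sum K G * f) = - (gr_sum K _ * gr_link c f).
Proof.
rewrite /gr_link !gr_contr_sumM -[RHS]mulrN -[- gr_res _ _]linearN.
rewrite -gr_res_sumM /=; congr (gr_res _ _).
by rewrite !opprB mulrBr addrC subrKA.
Qed.

(** A set off [star c] is also off [star x], so adding either [c] or [x] keeps it independent. *)
Lemma gr_link_ideal c f : star x \subset star c ->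
  f \in edge_ideal K G -> gr_link c f \in edge_ideal K (del (star c)).
Proof.
move=> xc fI; apply/edge_idealP => T iT; rewrite gr_resE gr_subE.
have Tc : [disjoint del_val @: T & star c].
  by rewrite disjoint_subset; apply/subsetP => _ /imsetP[d _ ->]; apply: del_valP.
rewrite !gr_contr_ideal_eq0 ?subr0 ?independent_del_val //.
exact: disjointWr xc Tc.
Qed.

(** The truncation keeps only sets that stay independent when [x] is added, which lets the map
    descend to A_G. *)
Definition gr_homotopy f : grassmann K G :=
  [ffun U : {set G} => if [disjoint U & star x] then gr_contr x f U else 0].

Lemma gr_homotopyE f U : gr_homotopy f U =
  if [disjoint U & star x] then gr_contr x f U else 0.
Proof. by rewrite ffunE. Qed.

Lemma gr_homotopy_is_linear : linear gr_homotopy.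
Proof.
move=> k f1 f2; apply/ffunP => U; rewrite ffunE linearP !ffunE.
by case: ifP => // _; rewrite ?ffunE // scaler0 addr0.
Qed.

HB.instance Definition _ := GRing.isSemilinear.Build K (grassmann K G)
  (grassmann K G) _ gr_homotopy (GRing.semilinear_linear gr_homotopy_is_linear).

Lemma gr_homotopy_ideal f :
  f \in edge_ideal K G -> gr_homotopy f \in edge_ideal K G.
Proof.
move=> fI; apply/edge_idealP => U iU; rewrite gr_homotopyE; case: ifP => // Ux.
exact: gr_contr_ideal_eq0.
Qed.

Hypothesis clique : {in star x &, forall y z, y != z -> adj y z}.

Lemma star_subset c : c \in star x -> star x \subset star c.
Proof.
move=> cx; apply/subsetP => y yx; rewrite !inE; have [//|nyc] := eqVneq y c.
by rewrite clique // eq_sym.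
Qed.

(** All terms still carrying the generator [c] die on restriction, because [c] is deleted with
    [star b]. *)
Lemma gr_link_genM c b f : c \in nbhd x -> c \in star b ->
  gr_link b (gr_gen K c * f) = gr_res (star b) f *+ (c == b).
Proof.
move=> cx cb; have nxc : c != x.
  by apply: contraTneq cx => ->; rewrite inE adj_irrefl.
rewrite /gr_link !gr_contr_genM (negPf nxc) mulr0n sub0r opprK -addrA addrC.
rewrite [- _ + _]addrC -mulrBr [LHS]linearD /= gr_res_genM_del // add0r.
by rewrite [LHS]linearMn.
Qed.

Lemma gr_link_join c (g : grassmann K (del (star c))) :
  c \in nbhd x -> gr_link c (gr_join g) = g.
Proof. by move=> cx; rewrite gr_link_genM ?setU11 // eqxx gr_extK. Qed.

Lemma gr_link_join0 c b (g : grassmann K (del (star c))) :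
  c \in nbhd x -> b \in nbhd x -> c != b -> gr_link b (gr_join g) = 0.
Proof.
move=> cx bx cb; rewrite gr_link_genM // ?(negPf cb) //.
by rewrite (subsetP (star_subset _)) // setU1r.
Qed.

(* An independent set meets the clique star x in at most one vertex y, and on *)
(* its coefficient x_y * contr_y acts as the identity. *)
Lemma gr_homotopyP f :
  (f - \sum_(c in nbhd x) gr_join (gr_link c f))
    - (gr_sum K G * gr_homotopy f + gr_homotopy (gr_sum K G * f))
    \in edge_ideal K G.
Proof.
(* Modulo the ideal, restricting and extending again has no effect after multiplication by [c]. *)
have joinE : \sum_(c in nbhd x) gr_join (gr_link c f) -
    \sum_(c in nbhd x) gr_gen K c * (gr_contr c f - gr_contr x f) \in edge_ideal K G.
  rewrite -sumrB rpred_sum // => c cx; rewrite /gr_join -mulrBr.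
  by apply: gr_genM_ideal; rewrite linearB /= gr_extK subrr mem0v.
set J := \sum_(c in _) _ in joinE *; set L := \sum_(c in _) _ in joinE.
set H := gr_sum K G * _ + _; have -> : f - J - H = f - L - H - (J - L).
  by rewrite opprB [RHS]addrAC [f - L + _]addrA subrK.
rewrite rpredB // {J joinE}.
apply/edge_idealP => U iU.
rewrite !gr_subE /L /H {L H} sum_ffunE.
have -> (f1 f2 : grassmann K G) : (f1 + f2) U = f1 U + f2 U by rewrite ffunE.
have genE y (g : grassmann K G) : y \notin U -> (gr_gen K y * g) U = 0.
  by move=> yU; rewrite gr_genME (negPf yU).
(* If [U] misses [star x], so do its subsets: the truncation is invisible, no neighbour contributes,
   and the contraction formula gives the claim. *)
rewrite gr_homotopyE gr_contr_sumM gr_subE; case: ifPn => Ux.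
  rewrite big1 ?subr0 => [|c cx]; last first.
    by apply: genE; rewrite (disjointFl Ux) // setU1r.
  rewrite addrCA opprD addrA subrr sub0r.
  apply/eqP; rewrite oppr_eq0 subr_eq0 !mulr_suml !sum_ffunE.
  apply/eqP/eq_bigr => y _; rewrite !gr_genME; case: ifP => // _.
  by rewrite gr_homotopyE (disjointWl (subD1set _ _) Ux).
have /pred0Pn[y /andP[/= yU yx]] := Ux.
have meet z : z \in star x -> z != y -> z \notin U.
  move=> zx zy; apply/negP => zU; have /independentP/(_ z y zU yU) := iU.
  by rewrite clique.
(* Removing any vertex other than [y] leaves [y] in the set, where the truncated map vanishes. *)
have homE : (gr_sum K G * gr_homotopy f) U = (gr_gen K y * gr_contr x f) U.
  rewrite mulr_suml sum_ffunE (bigD1 y) //= !gr_genME yU gr_homotopyE.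
  rewrite (disjointWr (star_subset yx)) ?independent_star // big1 ?addr0 // => z zy.
  rewrite gr_genME; case: ifP => // zU; rewrite gr_homotopyE ifN ?mulr0 //.
  by apply/pred0Pn; exists y; rewrite /= yx !inE eq_sym zy yU.
(* For [y = x] the homotopy term alone recovers [f]. For [y] a neighbour, it cancels the
   [gr_contr x] part of the one surviving summand, whose [gr_contr y] part recovers [f]. *)
rewrite addr0 homE; have [yE|nyx] := eqVneq y x.
  have -> : (gr_gen K y * gr_contr x f) U = f U by rewrite yE gr_genM_contr -?yE.
  rewrite big1 ?subr0 ?subrr // => c cx; apply/genE/meet; first exact: setU1r.
  by rewrite yE; apply: contraTneq cx => ->; rewrite inE adj_irrefl.
have yN : y \in nbhd x by case/setU1P: yx nyx => // ->; rewrite eqxx.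
rewrite (bigD1 y) //= big1 => [|c /andP[cx cy]]; last first.
  by apply: genE; apply: meet; rewrite ?setU1r.
by rewrite mulrBr gr_subE gr_genM_contr // addr0 subKr subrr.
Qed.

End Vertex.
End Link.

(** * Passage to the quotient algebras and to homology *)

Theorem theorem9p3 (K : fieldType) (G : sgraph) (x : G)
    (n : nat) (a : 'I_n -> G)
    (n_ge1 : (1 <= n)%N)
    (a_inj : injective a)
    (nbhd_x : nbhd x = [set a i | i : 'I_n])
    (a_adj : forall i j : 'I_n, i != j -> adj (a i) (a j)) :
  exists f : {linear HA K G ->
                dirsum (fun i : 'I_n => HA K (del (a i |: nbhd (a i))))},
    bijective f.
Proof.
have clique : {in x |: nbhd x &, forall y z, y != z -> adj y z}.
  move=> y z /setU1P[->|yx] /setU1P[->|zx]; first by rewrite eqxx.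
  - by move: zx; rewrite inE.
  - by move: yx; rewrite inE adj_sym.
  move: yx zx; rewrite nbhd_x => /imsetP[i _ ->] /imsetP[j _ ->].
  by rewrite (inj_eq a_inj); apply: a_adj.
have ax i : a i \in nbhd x by rewrite nbhd_x imset_f.
have ax1 i : a i \in x |: nbhd x by apply: setU1r.
have linkI i f := @gr_link_ideal K G x (a i) f (star_subset clique (ax1 i)).
have joinI i g := @gr_join_ideal K G (a i) g.
pose Psi i : {linear edge_algebra K G -> edge_algebra K _} := vquot_lift (linkI i).
pose Phi i : {linear edge_algebra K _ -> edge_algebra K G} := vquot_lift (joinI i).
pose h : {linear edge_algebra K G -> edge_algebra K G} :=
  vquot_lift (@gr_homotopy_ideal K G x).
have PsiE i f : Psi i (ea_pi f) = ea_pi (gr_link x (a i) f) by apply: vquot_liftE.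
have PhiE i g : Phi i (ea_pi g) = ea_pi (gr_join g) by apply: vquot_liftE.
have hE f : h (ea_pi f) = ea_pi (gr_homotopy x f) by apply: vquot_liftE.
clearbody Psi Phi h.
have piK (H : sgraph) (u : edge_algebra K H) : exists f, u = ea_pi f.
  by exists (repr u); rewrite /ea_pi vpi_surj.
have pi_eq (H : sgraph) (f g : grassmann K H) :
    f - g \in edge_ideal K H -> ea_pi f = ea_pi g.
  by move=> fg; apply/eqP; rewrite vpi_eq.
apply: (homology_dirsum (Psi := Psi) (Phi := Phi) (h := h)).
- move=> i u; have [f ->] := piK _ u; rewrite ea_diffE !PsiE ea_diffE gr_link_sumM.
  by rewrite /ea_pi linearN opprK.
- move=> i u; have [f ->] := piK _ u; rewrite ea_diffE !PhiE ea_diffE -[RHS]linearN.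
  by apply: pi_eq; rewrite opprK gr_join_sumM.
- by move=> i u; have [f ->] := piK _ u; rewrite PhiE PsiE gr_link_join.
- move=> i j u nij; have [f ->] := piK _ u; rewrite PhiE PsiE gr_link_join0 ?(inj_eq a_inj) //.
  by rewrite /ea_pi linear0.
move=> u; have [f ->] := piK _ u; rewrite ea_diffE !hE ea_diffE.
under eq_bigr do rewrite PsiE PhiE.
rewrite /ea_pi -linear_sum -linearB -linearD; apply: pi_eq.
have := gr_homotopyP clique f.
by rewrite nbhd_x big_imset //= => i j _ _; apply: a_inj.
Qed.
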